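(* Let $\Omega$ be a sample space, let $\mathcal{C}\subset\mathcal{P}(\Omega)$ be a field on $\Omega$, and let $P:\mathcal{C}\to\mathbb{R}$ be a price assignment. Then $P$ is system-2A-rational if and only if $P$ is a countably additive probability.
   Context: $\mathcal{C}$ is the set of events for which prices are assigned; a price assignment is a function $P:\mathcal{C}\to\mathbb{R}$. $I_A$ denotes the indicator function of $A\subset\Omega$, and $\mathbb{Z}^{+}=\{1,2,3,\ldots\}$. A betting portfolio is a sequence $(\alpha_i,A_i)_{i\in\mathbb{Z}^{+}}$ with $\alpha_i\in\mathbb{R}$ and $A_i\in\mathcal{C}$. A betting system is a collection of betting portfolios. Betting system 2A (for given $(\Omega,\mathcal{C},P)$) consists of exactly those betting portfolios $(\alpha_i,A_i)_{i\in\mathbb{Z}^{+}}$ such that for all $w\in\Omega$, $\sum_{i=1}^{\infty}|\alpha_i(I_{A_i}(w)-P(A_i))|<\infty$. $P$ is irrational in a given betting system if there exists a betting portfolio $(\alpha_i,A_i)_{i\in\mathbb{Z}^{+}}$ in that system such that for all $w\in\Omega$, $\sum_{i=1}^{\infty}\alpha_i(I_{A_i}(w)-P(A_i))<0$. $P$ is rational in the system if it is not irrational in it; system-2A-rational means rational in betting system 2A. For a field $\mathcal{C}$, $P$ is a finitely additive probability if $0\le P(A)\le 1$ for all $A\in\mathcal{C}$, $P(\Omega)=1$, and $P(A\cup B)=P(A)+P(B)$ for all disjoint $A,B\in\mathcal{C}$. $P$ is a countably additive probability if in addition, for every sequence $(A_i)_{i\ge1}$ of disjoint sets in $\mathcal{C}$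 with $\bigcup_{i\ge1}A_i\in\mathcal{C}$, $P(\bigcup_{i\ge1}A_i)=\sum_{i=1}^{\infty}P(A_i)$. *)

(* Defs.v *)
From HB Require Import structures.
From mathcomp Require Import all_boot all_order all_algebra.
From mathcomp Require Import all_classical all_reals all_analysis.
Import Order.TTheory GRing.Theory Num.Theory.
Import numFieldNormedType.Exports.

Set Implicit Arguments.
Unset Strict Implicit.
Unset Printing Implicit Defensive.

Local Open Scope classical_set_scope.
Local Open Scope ring_scope.

(* A collection of events [C : set (set Omega)] is used as a type through the
   coercion [set_type], so that a price assignment [P : C -> R] is defined on
   the priced events only. *)
Section betting.
Context {R : realType} {Omega : Type} {C : set (set Omega)}.

(* Sequences are indexed from 0 instead of 1. *)
Definition portfolio : Type := nat -> R * C.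

Definition betting_system : Type := set portfolio.

Definition gain (P : C -> R) (p : portfolio) (w : Omega) (i : nat) : R :=
  (p i).1 * (\1_(\val (p i).2) w - P (p i).2).

Definition system2A (P : C -> R) : betting_system :=
  [set p | forall w : Omega, cvgn (series (fun i => `|gain P p w i|))].

(* The convergence of the series of gains is part of the definition because it
   does not follow from membership in an arbitrary betting system. *)
Definition irrational_in (S : betting_system) (P : C -> R) : Prop :=
  exists2 p : portfolio, S p &
    forall w : Omega, exists2 l : R, series (gain P p w) @ \oo --> l & l < 0.

Definition rational_in (S : betting_system) (P : C -> R) : Prop :=
  ~ irrational_in S P.

Definition system2A_rational (P : C -> R) : Prop :=
  rational_in (system2A P) P.

End betting.

Arguments portfolio R {Omega} C.
Arguments betting_system R {Omega} C.

(* The library structure [algebraOfSetsType] is not used because it requires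
   its carrier to be pointed, hence nonempty. *)
Definition field_of_sets {Omega : Type} (C : set (set Omega)) : Prop :=
  [/\ C setT, setC_closed C & setU_closed C].

Definition event {Omega : Type} {C : set (set Omega)} (A : set Omega)
    (CA : C A) : C :=
  exist _ A (mem_set CA).

(* The notions below are meant for a field of sets [C]; the hypotheses [CT] and
   [CU] of [finitely_additive_probability] are then always satisfied. *)
Section probability_on_field.
Context {R : realType} {Omega : Type} {C : set (set Omega)}.
Implicit Type P : C -> R.

Definition finitely_additive_probability P : Prop :=
  [/\ forall A : C, 0 <= P A <= 1,
      forall CT : C setT, P (event CT) = 1 &
      forall (A B : set Omega) (CA : C A) (CB : C B) (CU : C (A `|` B)),
        A `&` B = set0 -> P (event CU) = P (event CA) + P (event CB)].

Definition countably_additive_probability P : Prop :=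
  finitely_additive_probability P /\
  forall (A : nat -> set Omega) (CA : forall i, C (A i))
      (CU : C (\bigcup_i A i)),
    trivIset setT A ->
    series (fun i => P (event (CA i))) @ \oo --> P (event CU).

End probability_on_field.

(* Main.v *)
From HB Require Import structures.
Require Import Defs.
From mathcomp Require Import all_boot all_order all_algebra.
From mathcomp Require Import all_classical all_reals all_analysis.
From mathcomp Require Import measurable_realfun ring lra.
Import Order.TTheory GRing.Theory Num.Theory.
Import numFieldNormedType.Exports.

Set Implicit Arguments.
Unset Strict Implicit.
Unset Printing Implicit Defensive.

Local Open Scope classical_set_scope.
Local Open Scope ring_scope.

(** If prices are rational, every axiom of probability follows from a portfolio
    that would otherwise lose for sure: a single bet for the bounds, and
    portfolios whose gain does not depend on the outcome for the normalization and
    the two additivity properties.  A constant gain must vanish, since changing the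
    sign of all stakes turns a positive constant into a negative one
    ([rational_sure_gain]).

    Conversely, let P be a countably additive probability and extend it to a
    probability measure mu on the sigma-algebra generated by C (Caratheodory).
    Every bet a (1_A - p), with p the price of A, has mean zero, and what has to be
    shown is that the sum of the gains has mean zero too; then it cannot be negative
    everywhere.  Pointwise absolute convergence alone does not allow the exchange
    of sum and integral for general mean-zero functions.  It does for bets, because
    the mean of |1_A - p| is 2 p (1 - p), at most twice min(p, 1 - p), and
    min(p, 1 - p) is a lower bound of |1_A - p| at every point.  Hence
    absolute convergence at any one outcome makes the mean absolute gains summable
    ([integral_abs_bet_le]), and dominated convergence concludes
    ([no_sure_loss]). *)

(** * Series of bets under a probability measure *)

(** The sum of the |f i| is an integrable bound for the partial sums, so dominated
    convergence applies. *)
Lemma integral_limit_series_eq0 d (T : measurableType d) (R : realType)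
    (mu : {measure set T -> \bar R}) (f : nat -> T -> R) (F : T -> R) :
    (forall i, measurable_fun setT (f i)) ->
    (forall x, series (f ^~ x) @ \oo --> F x) ->
    (\sum_(i <oo) \int[mu]_x `|f i x|%:E < +oo)%E ->
    (forall i, \int[mu]_x (f i x)%:E = 0)%E ->
  mu.-integrable setT (EFin \o F) /\ (\int[mu]_x (F x)%:E = 0)%E.
Proof.
move=> mf fF sumf f0.
have nf i : measurable_fun setT ((fun x => `|f i x|%:E) : T -> \bar R).
  by apply/measurable_EFinP; exact: measurableT_comp.
have intf i : mu.-integrable setT (EFin \o f i).
  apply/integrableP; split; first exact/measurable_EFinP.
  apply: le_lt_trans sumf.
  apply: (le_trans _ (nneseries_lim_ge i.+1 _)) => [|n _ _]; last first.
    by apply: integral_ge0.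
  by rewrite big_nat_recr//= leeDr// sume_ge0// => j _; exact: integral_ge0.
pose g x : \bar R := (\sum_(i <oo) `|f i x|%:E)%E.
have intg : mu.-integrable setT g.
  apply/integrableP; split.
    exact: ge0_emeasurable_sum.
  rewrite (eq_integral g) => [|x _]; last by rewrite gee0_abs// nneseries_ge0.
  by rewrite integral_nneseries.
pose S n : T -> \bar R := EFin \o (fun x => series (f ^~ x) n).
have mS n : measurable_fun setT (S n).
  by apply/measurable_EFinP; exact: measurable_sum.
have SF x : S ^~ x @ \oo --> (EFin \o F) x.
  by apply/cvg_EFin; [exact: nearW | exact: fF].
have mF : measurable_fun setT (EFin \o F : T -> \bar R).
  exact: (emeasurable_fun_cvg S).
have Sg : {ae mu, forall x n, setT x -> (`|S n x| <= g x)%E}.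
  apply: aeW => x n _; apply: (le_trans _ (nneseries_lim_ge n _)) => //.
  by rewrite sumEFin lee_fin; exact: ler_norm_sum.
have [intF _ cvgS] := dominated_convergence measurableT mS mF
  (aeW mu (fun x _ => SF x)) intg Sg.
split => //; rewrite -(cvg_lim _ cvgS)//.
rewrite [X in X @ _](_ : _ = cst 0%E) ?lim_cst//; apply/funext => n.
transitivity (\int[mu]_x (\sum_(0 <= i < n) (EFin \o f i) x)%E)%E => /=.
  by apply: eq_integral => x _; rewrite sumEFin.
by rewrite integral_sum// big1.
Qed.

Lemma integral_lt0_eq0_measure0 d (T : measurableType d) (R : realType)
    (mu : {measure set T -> \bar R}) (F : T -> R) :
    mu.-integrable setT (EFin \o F) -> (forall x, F x < 0) ->
  (\int[mu]_x (F x)%:E = 0)%E -> mu setT = 0%E.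
Proof.
move=> iF F0 intF.
have : (\int[mu]_x `|(F x)%:E| = 0)%E.
  transitivity (\int[mu]_x - (F x)%:E)%E.
    by apply: eq_integral => x _; rewrite abse_EFin ltr0_norm.
  by rewrite integralN ?intF ?oppe0//; exact: integrable_add_def.
have mEF := measurable_int mu iF.
move=> /(ae_eq_integral_abs mu measurableT mEF) [N [mN N0 sub]].
apply/eqP; rewrite -measure_le0 -N0 le_measure ?inE// => x _.
by apply: sub => /= /(_ I) [] Fx; have := F0 x; rewrite Fx ltxx.
Qed.

Lemma integral_affine_indic d (T : measurableType d) (R : realType)
    (mu : probability T R) (A : set T) (p b c : R) :
    measurable A -> mu A = p%:E ->
  (\int[mu]_x (b * \1_A x + c)%:E = (b * p + c)%:E)%E.
Proof.
move=> mA muA.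
have iA := integrable_indic mu mA.
have ic : mu.-integrable setT (EFin \o cst c).
  exact: finite_measure_integrable_cst.
transitivity (\int[mu]_x (b%:E * (\1_A x)%:E + (EFin \o cst c) x))%E => //.
rewrite integralD//; last exact: integrableZl.
rewrite integralZl// integral_indic// setIT.
rewrite (_ : \int[mu]_x (EFin \o cst c) x = c%:E * mu setT)%E; last first.
  exact: (integral_cst mu measurableT c%:E).
by rewrite [X in (b%:E * X)%E]muA [X in (c%:E * X)%E]probability_setT mule1.
Qed.

Lemma integral_bet_eq0 d (T : measurableType d) (R : realType)
    (mu : probability T R) (A : set T) (p a : R) :
    measurable A -> mu A = p%:E ->
  (\int[mu]_x (a * (\1_A x - p))%:E = 0)%E.
Proof.
move=> mA muA; under eq_integral do rewrite mulrBr.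
by rewrite (integral_affine_indic _ _ mA muA) subrr.
Qed.

(** The integral is 2|a|p(1 - p), which is at most 2|a| min(p, 1 - p), while
    |1_A - p| takes only the values p and 1 - p.  So the value at a single
    point, whichever it is, controls the mean. *)
Lemma integral_abs_bet_le d (T : measurableType d) (R : realType)
    (mu : probability T R) (A : set T) (p a : R) (x : T) :
    measurable A -> mu A = p%:E ->
  (\int[mu]_y `|a * (\1_A y - p)|%:E <= (2 * `|a * (\1_A x - p)|)%:E)%E.
Proof.
move=> mA muA.
have /andP[p0 p1] : 0 <= p <= 1.
  by rewrite -!lee_fin -muA measure_ge0 probability_le1.
have abs_affine y :
    `|a * (\1_A y - p)| = `|a| * (1 - 2 * p) * \1_A y + `|a| * p.
  rewrite normrM -mulrA -mulrDr; congr (_ * _).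
  rewrite indicE; case: (_ \in _) => /=.
    by rewrite ger0_norm ?subr_ge0//; lra.
  by rewrite ler0_norm; lra.
under eq_integral do rewrite abs_affine.
rewrite (integral_affine_indic _ _ mA muA) lee_fin.
have -> : `|a| * (1 - 2 * p) * p + `|a| * p = 2 * (`|a| * (p * (1 - p))).
  by ring.
rewrite ler_pM2l// normrM ler_wpM2l//.
rewrite indicE; case: (_ \in _) => /=.
  by rewrite ger0_norm ?subr_ge0//; nra.
by rewrite ler0_norm; nra.
Qed.

(** Absolute convergence at one point already makes the mean absolute gains
    summable, so the total gain is integrable with mean zero; a function that is
    negative everywhere has mean zero only if the total mass is zero. *)
Lemma no_sure_loss d (T : measurableType d) (R : realType)
    (mu : probability T R) (A : nat -> set T) (p a : nat -> R) :
    (forall i, measurable (A i)) -> (forall i, mu (A i) = (p i)%:E) ->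
    (forall x, cvgn (series (fun i => `|a i * (\1_(A i) x - p i)|))) ->
  ~ (forall x,
      exists2 l : R, series (fun i => a i * (\1_(A i) x - p i)) @ \oo --> l &
                     l < 0).
Proof.
move=> mA muA cvga loss.
pose f i x := a i * (\1_(A i) x - p i).
have mf i : measurable_fun setT (f i).
  by apply: measurable_funM => //; apply: measurable_funB => //.
have sumf : (\sum_(i <oo) \int[mu]_x `|f i x|%:E < +oo)%E.
  pose x0 : T := point.
  apply: (@le_lt_trans _ _ (\sum_(i <oo) (2 * `|f i x0|)%:E)%E).
    apply: lee_nneseries => i _; first by move=> _; exact: integral_ge0.
    exact: integral_abs_bet_le.
  rewrite (_ : (\sum_(i <oo) (2 * `|f i x0|)%:E)%E =
      (limn (series (fun i => 2 * `|f i x0|)))%:E) ?ltry//.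
  rewrite -EFin_lim; last exact: (@is_cvg_seriesZ _ _ 2 (cvga x0)).
  by congr (limn _); apply/funext => n /=; rewrite sumEFin.
have /choice[F FP] x :
    exists l : R, series (f ^~ x) @ \oo --> l /\ l < 0.
  by have [l fl l0] := loss x; exists l.
have [iF F0] := integral_limit_series_eq0 mf (fun x => (FP x).1) sumf
  (fun i => integral_bet_eq0 _ (mA i) (muA i)).
have := integral_lt0_eq0_measure0 iF (fun x => (FP x).2) F0.
by rewrite [X in X = _]probability_setT => /eqP; rewrite onee_eq0.
Qed.

(** * Extension of a probability on a field to a measure *)

Lemma event_eq {Omega : Type} {C : set (set Omega)} (A B : set Omega)
  (CA : C A) (CB : C B) : A = B -> event CA = event CB.
Proof. by move=> AB; apply: val_inj. Qed.

(** A copy of [Omega] that carries [C] as its algebra of measurable sets.  The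
    point [w] is part of the type because measurable structures are pointed. *)
Definition field_space {Omega : Type} {C : set (set Omega)}
  (hC : field_of_sets C) (w : Omega) : Type := Omega.

Section field_space.
Context {Omega : Type} {C : set (set Omega)} (hC : field_of_sets C) (w : Omega).
Local Notation T := (field_space hC w).

HB.instance Definition _ := gen_eqMixin T.
HB.instance Definition _ := gen_choiceMixin T.
HB.instance Definition _ := isPointed.Build T w.

Lemma field_set0 : C set0.
Proof. by case: hC => CT CC _; rewrite -setCT; exact: CC. Qed.

Lemma field_setU : setU_closed C.
Proof. by case: hC. Qed.

Lemma field_setC : setC_closed C.
Proof. by case: hC. Qed.

HB.instance Definition _ := @isAlgebraOfSets.Build default_measure_display T
  C field_set0 field_setU field_setC.

Context {R : realType} (P : C -> R) (hP : countably_additive_probability P).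

(** Set functions are total; the default 0 keeps the values outside [C]
    nonnegative. *)
Definition field_measure (A : set T) : \bar R :=
  if pselect (C A) is left CA then (P (event CA))%:E else 0%E.

Lemma field_measureE (A : set T) (CA : C A) :
  field_measure A = (P (event CA))%:E.
Proof.
rewrite /field_measure; case: pselect => // CA'.
by rewrite (event_eq CA' CA).
Qed.

Let field_measure0 : field_measure set0 = 0%E.
Proof.
have [[_ _ addP] _] := hP.
have CU := field_setU field_set0 field_set0.
have := addP _ _ field_set0 field_set0 CU (setI0 _).
rewrite (event_eq CU field_set0 (setU0 _)) => /eqP.
rewrite -subr_eq0 opprD addNKr oppr_eq0 => /eqP P0.
by rewrite (field_measureE field_set0) P0.
Qed.

Let field_measure_ge0 (A : set T) : (0 <= field_measure A)%E.
Proof.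
have [[P01 _ _] _] := hP.
by rewrite /field_measure; case: pselect => // CA; case/andP: (P01 (event CA)).
Qed.

Let field_measure_sigma_additive : semi_sigma_additive field_measure.
Proof.
move=> F mF tF mU; have [_ addP] := hP.
rewrite (field_measureE mU).
apply: (@cvg_trans _ ((EFin \o series (fun i => P (event (mF i)))) @ \oo)).
  apply: near_eq_cvg; apply: nearW => n /=.
  by rewrite -sumEFin; apply: eq_bigr => i _; rewrite (field_measureE (mF i)).
by apply/cvg_EFin; [exact: nearW|exact: addP].
Qed.

HB.instance Definition _ := isMeasure.Build _ _ _ field_measure
  field_measure0 field_measure_ge0 field_measure_sigma_additive.

Definition field_extension :
    set (g_sigma_algebraType (@measurable _ T)) -> \bar R :=
  measure_extension field_measure.

HB.instance Definition _ := Measure.on field_extension.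

Lemma field_extensionE A (CA : C A) : field_extension A = (P (event CA))%:E.
Proof.
rewrite /field_extension /measure_extension measurable_mu_extE//.
exact: field_measureE.
Qed.

Let field_extensionT : field_extension setT = 1%E.
Proof.
have [CT _ _] := hC; have [[_ P1 _] _] := hP.
by rewrite (field_extensionE CT) P1.
Qed.

HB.instance Definition _ :=
  Measure_isProbability.Build _ _ _ field_extension field_extensionT.

End field_space.

Arguments field_extension {Omega C} hC w {R P} hP.
Arguments field_extensionE {Omega C} hC w {R P} hP [A] CA.

(** On the empty space, the whole space is disjoint from itself, and additivity
    would give it probability 2. *)
Lemma finitely_additive_probability_nonempty {R : realType} {Omega : Type}
    {C : set (set Omega)} (hC : field_of_sets C) (P : C -> R) :
  finitely_additive_probability P -> inhabited Omega.
Proof.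
move=> [P01 P1 addP]; apply: contrapT => Omega0; have [CT _ CUn] := hC.
have T0 : [set: Omega] = set0.
  by apply/seteqP; split => // w _; case: Omega0; exists.
have CU := CUn _ _ CT CT; have := addP _ _ CT CT CU.
rewrite {2}T0 setI0 => /(_ erefl); rewrite P1.
have /andP[_] := P01 (event CU); lra.
Qed.

(** * Portfolios against irrational prices *)

Section portfolios.
Context {R : realType} {Omega : Type} {C : set (set Omega)} (P : C -> R).

Definition bet_gain (b : R * C) (w : Omega) : R :=
  b.1 * (\1_(\val b.2) w - P b.2).

(** The gain is a function of the outcome and not a constant because the bets on a
    single event do not have a constant gain. *)
Definition pays (p : portfolio R C) (G : Omega -> R) : Prop :=
  system2A P p /\ forall w, series (gain P p w) @ \oo --> G w.

Definition bet_cons (b : R * C) (p : portfolio R C) : portfolio R C :=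
  fun i => if i is j.+1 then p j else b.

Lemma rational_pays p G : system2A_rational P -> pays p G ->
  ~ (forall w, G w < 0).
Proof.
move=> ratP [sp pG] G0; apply: ratP; exists p => // w.
by exists (G w).
Qed.

Lemma cvg_series_cons (u : nat -> R) l :
  series (fun i => u i.+1) @ \oo --> l -> series u @ \oo --> u 0 + l.
Proof.
move=> ul; rewrite -cvg_shiftS /=.
under eq_fun do rewrite /series /= big_nat_recl//.
by apply: cvgD => //; exact: cvg_cst.
Qed.

Lemma pays_cons b p G : pays p G ->
  pays (bet_cons b p) (fun w => bet_gain b w + G w).
Proof.
move=> [sp pG]; split=> w; last first.
  exact: (cvg_series_cons (u := gain P (bet_cons b p) w) (pG w)).
apply/cvg_ex; eexists.
exact: (cvg_series_cons (u := fun i => `|gain P (bet_cons b p) w i|) (sp w)).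
Qed.

Lemma pays_opp p G : pays p G ->
  pays (fun i => (- (p i).1, (p i).2)) (fun w => - G w).
Proof.
move=> [sp pG].
have gN w : gain P (fun i => (- (p i).1, (p i).2)) w = - gain P p w.
  by apply/funext => i; rewrite /gain mulNr.
split=> w.
  rewrite gN; under eq_fun do rewrite normrN; exact: sp.
by rewrite gN seriesN; apply: cvgN.
Qed.

(** A constant negative total is a sure loss; a constant positive one becomes a sure
    loss when all stakes change sign. *)
Lemma rational_sure_gain p l : system2A_rational P -> pays p (fun=> l) -> l = 0.
Proof.
move=> ratP pl; case: (ltgtP l 0) => // l0; exfalso.
  exact: (rational_pays ratP pl).
by apply: (rational_pays ratP (pays_opp pl)) => w; rewrite oppr_lt0.
Qed.

(** The tail consists of zero stakes on [A], an event that has to be supplied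
    because every position of a portfolio carries one. *)
Definition finite_portfolio (A : C) (s : seq (R * C)) : portfolio R C :=
  foldr bet_cons (fun=> (0, A)) s.

Lemma pays_finite A s :
  pays (finite_portfolio A s) (fun w => \sum_(b <- s) bet_gain b w).
Proof.
elim: s => [|b s IHs] /=.
  have g0 w : gain P (fun=> (0, A)) w = cst 0.
    by apply/funext => i; rewrite /gain mul0r.
  have cvg0 : series (cst 0 : nat -> R) @ \oo --> (0 : R).
    rewrite (_ : series _ = cst 0); first exact: cvg_cst.
    by apply/funext => n; rewrite /series /= big1.
  split=> w; rewrite g0 ?big_nil//.
  under eq_fun do rewrite /cst normr0.
  by apply/cvg_ex; exists 0.
have -> : (fun w => \sum_(b <- b :: s) bet_gain b w) =
    (fun w => bet_gain b w + \sum_(b <- s) bet_gain b w).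
  by apply/funext => w; rewrite big_cons.
exact: pays_cons.
Qed.

Lemma cvg_series_indic (A : nat -> set Omega) w : trivIset setT A ->
  series (fun i => \1_(A i) w : R) @ \oo --> (\1_(\bigcup_i A i) w : R).
Proof.
move=> tA; have := @indic_bigcup _ R A w tA => sumA.
have cvgA : cvgn (series (fun i => \1_(A i) w : R)).
  by apply: nnseries_is_cvg => //; rewrite -sumA ltry.
suff -> : (\1_(\bigcup_i A i) w : R) = limn (series (fun i => \1_(A i) w : R)).
  exact: cvgA.
apply: EFin_inj; rewrite sumA -EFin_lim//.
by congr (limn _); apply/funext => n /=; rewrite sumEFin.
Qed.

(** Each outcome lies in at most one of the events, so the indicators are
    summable as the prices are, and each gain is bounded in absolute value by an
    indicator plus a price. *)
Lemma pays_disjoint (A : nat -> set Omega) (CA : forall i, C (A i)) l :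
    trivIset setT A -> (forall i, 0 <= P (event (CA i))) ->
    series (fun i => P (event (CA i))) @ \oo --> l ->
  pays (fun i => (1, event (CA i))) (fun w => \1_(\bigcup_i A i) w - l).
Proof.
move=> tA P0 cvgP.
have gE w i : gain P (fun i => (1, event (CA i))) w i =
    \1_(A i) w - P (event (CA i)) by rewrite /gain mul1r.
split=> w.
  pose v := (fun i => \1_(A i) w : R) + (fun i => P (event (CA i))).
  apply: (@series_le_cvg _ _ v) => [i|i|i|].
  - exact: normr_ge0.
  - by rewrite addr_ge0.
  - by rewrite gE (le_trans (ler_normB _ _))// !ger0_norm.
  - apply: is_cvg_seriesD; last by apply/cvg_ex; exists l.
    by apply/cvg_ex; eexists; exact: cvg_series_indic.
rewrite (_ : gain P _ w =
    (fun i => \1_(A i) w : R) - (fun i => P (event (CA i)))).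
  by rewrite seriesD seriesN; apply: cvgB => //; exact: cvg_series_indic.
by apply/funext => i; rewrite gE.
Qed.

(** Selling an event with a negative price loses at every outcome. *)
Lemma rational_ge0 A : system2A_rational P -> 0 <= P A.
Proof.
move=> ratP; rewrite leNgt; apply/negP => PA0.
apply: (rational_pays ratP (pays_finite A [:: (-1, A)])) => w.
by rewrite big_seq1 /bet_gain /= indicE; case: (_ \in _) => /=; lra.
Qed.

Lemma rational_le1 A : system2A_rational P -> P A <= 1.
Proof.
move=> ratP; rewrite leNgt; apply/negP => PA1.
apply: (rational_pays ratP (pays_finite A [:: (1, A)])) => w.
by rewrite big_seq1 /bet_gain /= indicE; case: (_ \in _) => /=; lra.
Qed.

Lemma rational_finite_sure_gain (A : C) (s : seq (R * C)) l :
    system2A_rational P -> (forall w, \sum_(b <- s) bet_gain b w = l) ->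
  l = 0.
Proof.
move=> ratP sl; apply: (rational_sure_gain ratP (p := finite_portfolio A s)).
have -> : (fun=> l) = fun w => \sum_(b <- s) bet_gain b w by apply/funext.
exact: pays_finite.
Qed.

Lemma rational_setT (CT : C setT) : system2A_rational P -> P (event CT) = 1.
Proof.
move=> ratP; apply/eqP; rewrite eq_sym -subr_eq0; apply/eqP.
pose s := [:: (1 : R, event CT)].
apply: (rational_finite_sure_gain (event CT) (s := s) ratP) => w.
by rewrite big_seq1 /bet_gain /= mul1r indicT.
Qed.

(** Selling the union and buying both parts pays a constant, because the
    indicators cancel. *)
Lemma rational_additive A B (CA : C A) (CB : C B) (CU : C (A `|` B)) :
  system2A_rational P -> A `&` B = set0 ->
  P (event CU) = P (event CA) + P (event CB).
Proof.
move=> ratP AB0; apply/eqP; rewrite -subr_eq0; apply/eqP.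
pose s := [:: (-1 : R, event CU); (1, event CA); (1, event CB)].
apply: (rational_finite_sure_gain (event CU) (s := s) ratP) => w.
rewrite /s !big_cons big_nil /bet_gain /=.
have -> : \1_(A `|` B) w = \1_A w + \1_B w :> R.
  rewrite !indicE in_setU; have := in_set0 w; rewrite -AB0 in_setI.
  by case: (w \in A); case: (w \in B) => //= _; rewrite ?addr0 ?add0r.
ring.
Qed.

(** If the first [n] prices added up to more than 1, then buying these events would
    be a sure loss, since at most one of them pays 1. *)
Lemma rational_sum_disjoint_le1 (A : nat -> set Omega)
    (CA : forall i, C (A i)) n :
  system2A_rational P -> trivIset setT A ->
  \sum_(0 <= i < n) P (event (CA i)) <= 1.
Proof.
move=> ratP tA; rewrite leNgt; apply/negP => sum1.
pose s := [seq (1 : R, event (CA i)) | i <- index_iota 0 n].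
apply: (rational_pays ratP (pays_finite (event (CA 0)) s)) => w.
rewrite /s big_map; under eq_bigr do rewrite /bet_gain /= mul1r.
rewrite sumrB; suff : \sum_(0 <= i < n) \1_(A i) w <= 1 :> R by lra.
have cvgA := @cvg_series_indic A w tA.
apply: (@le_trans _ _ (\1_(\bigcup_i A i) w)).
  rewrite -(cvg_lim _ cvgA)//.
  apply: (nondecreasing_cvgn_le (u_ := series (fun i => \1_(A i) w : R))).
    exact: nondecreasing_series.
  by apply/cvg_ex; eexists; exact: cvgA.
by rewrite indicE; case: (_ \in _).
Qed.

(** Selling the union and buying every part pays the price of the union minus the
    sum of the prices, at every outcome.  The portfolio is in the system because
    the prices are nonnegative with partial sums at most 1. *)
Lemma rational_sigma_additive (A : nat -> set Omega) (CA : forall i, C (A i))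
    (CU : C (\bigcup_i A i)) : system2A_rational P -> trivIset setT A ->
  series (fun i => P (event (CA i))) @ \oo --> P (event CU).
Proof.
move=> ratP tA.
have P0 i : 0 <= P (event (CA i)) by exact: rational_ge0.
have cvgP : cvgn (series (fun i => P (event (CA i)))).
  apply: nondecreasing_is_cvgn; first exact: nondecreasing_series.
  exists 1 => _ [n _ <-]; exact: rational_sum_disjoint_le1.
pose l := limn (series (fun i => P (event (CA i)))).
have lE : P (event CU) - l = 0.
  have := pays_cons (-1, event CU) (pays_disjoint tA P0 cvgP).
  rewrite (_ : (fun w => _) = fun=> P (event CU) - l); last first.
    by apply/funext => w; rewrite /bet_gain /l/=; ring.
  exact: rational_sure_gain.
by rewrite (subr0_eq lE).
Qed.

End portfolios.

(** * The equivalence *)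

Lemma rational_countably_additive (R : realType) (Omega : Type)
    (C : set (set Omega)) (P : C -> R) :
  system2A_rational P -> countably_additive_probability P.
Proof.
move=> ratP; split; last by move=> A CA CU; exact: rational_sigma_additive.
split=> [A|CT|A B CA CB CU].
- by rewrite rational_ge0// rational_le1.
- exact: rational_setT.
- exact: rational_additive.
Qed.

Lemma countably_additive_rational (R : realType) (Omega : Type)
    (C : set (set Omega)) (hC : field_of_sets C) (P : C -> R) :
  countably_additive_probability P -> system2A_rational P.
Proof.
move=> hP [p sp loss].
have [w] := finitely_additive_probability_nonempty hC hP.1.
pose A i : set Omega := val (p i).2.
have CA i : C (A i) by exact: set_mem (valP (p i).2).
apply: (@no_sure_loss _ _ _ (field_extension hC w hP) A
  (fun i => P (p i).2) (fun i => (p i).1) _ _ sp loss) => i.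
  exact: sub_sigma_algebra.
rewrite [LHS](field_extensionE hC w hP (CA i)); congr (P _)%:E.
exact: val_inj.
Qed.

Theorem proposition2 (R : realType) (Omega : Type) (C : set (set Omega))
    (hC : field_of_sets C) (P : C -> R) :
  system2A_rational P <-> countably_additive_probability P.
Proof.
split; first exact: rational_countably_additive.
exact: countably_additive_rational.
Qed.
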